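(* Let $R=\mathbb{C}[x_1,\dots,x_N]$ be graded by a finitely generated abelian group $M$ via $\deg(x_i)=d_i\in M$, with $\dim_{\mathbb{C}}(R_0)=1$. Suppose that $I=\langle f_1,\dots,f_t\rangle\subseteq R$ is an $M$-graded ideal where each $f_i$ is $M$-homogeneous. For each $m\in M$, let $$C_0^m(I)=\left\{\partial\in D_0^m:\Phi_i(\partial)\in D_0^{m-d_i}(I)\text{ for }i=1,\dots,N\right\}$$ be the closedness subspace of degree $m$. Then, for each $m\in M$, $$D_0^m(I)=\left\{\partial\in C_0^m(I):\partial(f_i)=0\text{ for all }i\text{ such that }\deg(f_i)=m\right\}.$$
   Context: Grading: given $d_1,\dots,d_N\in M$, set $\deg(x^\alpha)=\sum_{i=1}^N\alpha_i d_i\in M$ for $\alpha\in(\mathbb{Z}_{\ge 0})^N$, and for $m\in M$ let $R_m=\mathrm{span}_{\mathbb{C}}\{x^\alpha : \deg(x^\alpha)=m\}$, so $R=\bigoplus_{m\in M}R_m$. A polynomial $f\in R_m$ is called $M$-homogeneous of degree $\deg f=m$. An ideal is $M$-graded if it is generated by $M$-homogeneous polynomials. Standing assumption: $\dim_{\mathbb{C}}(R_0)=1$, i.e. $R_0=\mathbb{C}$ (equivalently $\dim_{\mathbb{C}} R_m<\infty$ for all $m\in M$). Dual spaces: for $\alpha\in(\mathbb{Z}_{\ge 0})^N$ let $\partial_\alpha:R\to\mathbb{C}$ be the linear functional $\partial_\alpha(g)=\frac{1}{\alpha!}\frac{\partial^{|\alpha|}g}{\partial x_1^{\alpha_1}\cdots\partial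 x_N^{\alpha_N}}\Big|_{x=0}$, where $\alpha!=\prod_i\alpha_i!$ and $|\alpha|=\sum_i\alpha_i$ (i.e. the coefficient of $x^\alpha$ in $g$). Let $D_0=\mathrm{span}_{\mathbb{C}}\{\partial_\alpha:\alpha\in(\mathbb{Z}_{\ge 0})^N\}$ (finite linear combinations), and $D_0^m=\mathrm{span}_{\mathbb{C}}\{\partial_\alpha:\deg(x^\alpha)=m\}$ for $m\in M$. For an ideal $I$, $D_0(I)=\{\partial\in D_0:\partial(g)=0\text{ for all }g\in I\}$ and $D_0^m(I)=D_0^m\cap D_0(I)$. For $i=1,\dots,N$, the linear anti-differentiation operator $\Phi_i:D_0\to D_0$ is given by $\Phi_i(\partial_\alpha)=\partial_{\alpha-e_i}$ if $\alpha_i>0$ and $\Phi_i(\partial_\alpha)=0$ otherwise, where $e_i$ is the $i$-th standard basis vector; it maps $D_0^m$ to $D_0^{m-d_i}$. *)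

(* Defs.v *)
From HB Require Import structures.
From mathcomp Require Import all_boot all_order all_algebra.
From mathcomp Require Import boolp classical_sets functions cardinality fsbigop.
From mathcomp Require Import reals complex mpoly.

Set Implicit Arguments.
Unset Strict Implicit.
Unset Printing Implicit Defensive.

Import Order.TTheory GRing.Theory Num.Theory.

Local Open Scope ring_scope.
Local Open Scope classical_set_scope.

Section LinearAlgebra.
Variables (F : fieldType) (V : lmodType F).

Definition lin_span (A : set V) : set V :=
  [set v | exists n (c : 'I_n -> F) (u : 'I_n -> V),
     (forall i, A (u i)) /\ v = \sum_(i < n) c i *: u i].

Definition lin_indep n (b : 'I_n -> V) : Prop :=
  forall c : 'I_n -> F, \sum_(i < n) c i *: b i = 0 -> forall i, c i = 0.

Definition has_dim (A : set V) (n : nat) : Prop :=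
  exists b : 'I_n -> V, lin_indep b /\ A = lin_span (range b).

End LinearAlgebra.

Definition finitely_generated (M : zmodType) : Prop :=
  exists n (g : 'I_n -> M),
    forall x : M, exists z : 'I_n -> int, x = \sum_(i < n) g i *~ z i.

Section Grading.
Variables (F : numFieldType) (N : nat) (M : zmodType) (d : 'I_N -> M).

Definition mondeg (a : 'X_{1..N}) : M := \sum_(i < N) d i *+ a i.

(* The graded piece R_m; membership means "M-homogeneous of degree m".  The
   zero polynomial is M-homogeneous of every degree. *)
Definition graded_piece (m : M) : set {mpoly F[N]} :=
  lin_span [set 'X_[F, a] | a in [set a | mondeg a = m]].

Definition ideal_gen (G : set {mpoly F[N]}) : set {mpoly F[N]} :=
  [set p | exists n (h g : 'I_n -> {mpoly F[N]}),
     (forall i, G (g i)) /\ p = \sum_(i < n) h i * g i].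

Definition graded_ideal (I : set {mpoly F[N]}) : Prop :=
  exists G : set {mpoly F[N]},
    (forall g, G g -> exists m, graded_piece m g) /\ I = ideal_gen G.

End Grading.

Section DualSpace.
Variables (F : numFieldType) (N : nat).

(* All functions R -> F; the elements of D0 below are linear. *)
Local Notation dual := ({mpoly F[N]} -> F^o).

Definition mfact (a : 'X_{1..N}) : nat := (\prod_(i < N) (a i)`!)%N.

Definition pd (a : 'X_{1..N}) : dual :=
  fun g => (mfact a)%:R^-1 * (g^`M[a]).@[fun=> 0].

Definition D0 : set dual := lin_span (range pd).

Definition Phi_basis (i : 'I_N) (a : 'X_{1..N}) : dual :=
  if (0 < a i)%N then pd (a - U_(i))%MM else 0.

(* The linear extension of [Phi_basis i] from the basis [pd] of [D0]: the
   coordinate of v in D0 along [pd a] is v (x^a), see [D0_coord].  On D0 the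
   sum has finite support; the values outside D0 are irrelevant. *)
Definition Phi (i : 'I_N) (v : dual) : dual :=
  \sum_(a \in [set: 'X_{1..N}]) v 'X_[a] *: Phi_basis i a.

Definition D0_perp (I : set {mpoly F[N]}) : set dual :=
  [set v | D0 v /\ forall g, I g -> v g = 0].

Section GradedDual.
Variables (M : zmodType) (d : 'I_N -> M).

Definition D0_deg (m : M) : set dual :=
  lin_span [set pd a | a in [set a | mondeg d a = m]].

Definition D0_deg_perp (I : set {mpoly F[N]}) (m : M) : set dual :=
  D0_deg m `&` D0_perp I.

Definition closedness (I : set {mpoly F[N]}) (m : M) : set dual :=
  [set v | D0_deg m v /\ forall i, D0_deg_perp I (m - d i) (Phi i v)].

End GradedDual.
End DualSpace.

Section Facts.
Variables (F : numFieldType) (N : nat).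
Implicit Types (a b : 'X_{1..N}) (g : {mpoly F[N]}).
Local Notation dual := ({mpoly F[N]} -> F^o).

Lemma pdE a g : pd a g = g@_a.
Proof.
have mfact0 : (mfact a)%:R != 0 :> F.
  by rewrite pnatr_eq0 -lt0n prodn_gt0 // => i; rewrite fact_gt0.
have ev0 (p : {mpoly F[N]}) : p.@[fun=> 0] = p@_0%MM.
  rewrite {1}[p]mpolyE raddf_sum /= [X in _ = X@__]mpolyE raddf_sum /=.
  apply: eq_bigr => m _; rewrite mevalZ mevalX mcoeffZ mcoeffX; congr (_ * _).
  have [->|m0] := eqVneq m 0%MM.
    by rewrite big1 // => i _; rewrite mnm0E expr0.
  have [i mi] : exists i, m i != 0%N.
    apply/existsP; apply: contraNT m0; rewrite negb_exists => /forallP m0.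
    by apply/eqP/mnmP => i; rewrite mnm0E; apply/eqP; rewrite -[_ == _]negbK.
  by rewrite (bigD1 i) //= expr0n (negbTE mi) mul0r.
rewrite /pd ev0 mcoeff_mderivm.
have -> : (\prod_(i < N) ((a + 0)%MM i) ^_ (a i))%N = mfact a.
  by apply: eq_bigr => i _; rewrite addm0 ffactnn.
by rewrite addm0 -[g@_a *+ _]mulr_natl mulrA mulVf ?mul1r.
Qed.

Lemma D0_coord n (c : 'I_n -> F) (e : 'I_n -> 'X_{1..N}) a :
  (\sum_(i < n) c i *: (pd (e i) : dual)) 'X_[a] = \sum_(i < n | e i == a) c i.
Proof.
rewrite fct_sumE [RHS]big_mkcond; apply: eq_bigr => i _.
rewrite scalrfctE pdE mcoeffX eq_sym; case: eqP => _.
- exact: mulr1.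
- exact: mulr0.
Qed.

Lemma D0_finite (v : dual) : D0 v ->
  exists r : seq 'X_{1..N}, uniq r /\ forall a, a \notin r -> v 'X_[a] = 0.
Proof.
move=> [n [c [u [uP ->]]]].
have /choice [e eP] j : exists a, u j = pd a by have [a _ <-] := uP j; exists a.
exists (undup [seq e j | j <- enum 'I_n]); split; first exact: undup_uniq.
move=> a; rewrite mem_undup => ae; under eq_bigr do rewrite eP.
rewrite D0_coord big_pred0 // => j; apply: contraNF ae => /eqP <-.
by rewrite map_f ?mem_enum.
Qed.

Lemma PhiE i (v : dual) (r : seq 'X_{1..N}) : uniq r ->
    (forall a, a \notin r -> v 'X_[a] = 0) ->
  Phi i v = \sum_(a <- r) v 'X_[a] *: (Phi_basis i a : dual).
Proof.
move=> ur vr; rewrite /Phi (@fsbigE _ _ _ _ _ r) //; last first.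
  by move=> a _ /vr ->; rewrite scale0r.
by apply: eq_bigl => a; rewrite in_setT.
Qed.

Lemma Phi_pd i a :
  Phi i (pd a : dual) = if (0 < a i)%N then pd (a - U_(i))%MM else 0.
Proof.
rewrite (@PhiE _ _ [:: a]) //; last first.
  by move=> b; rewrite inE pdE mcoeffX => /negbTE ->.
by rewrite big_seq1 pdE mcoeffX eqxx scale1r.
Qed.

Lemma Phi_linear_D0 i (c : F) (v w : dual) : D0 v -> D0 w ->
  Phi i (c *: v + w) = c *: (Phi i v : dual) + Phi i w.
Proof.
move=> /D0_finite [r [_ vr]] /D0_finite [s [_ ws]].
pose t := undup (r ++ s).
have ut : uniq t by exact: undup_uniq.
have vt a : a \notin t -> v 'X_[a] = 0.
  by rewrite mem_undup mem_cat negb_or => /andP[/vr].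
have wt a : a \notin t -> w 'X_[a] = 0.
  by rewrite mem_undup mem_cat negb_or => /andP[_ /ws].
rewrite (PhiE i ut vt) (PhiE i ut wt) (@PhiE _ _ t) //; last first.
  move=> a ta; rewrite -[LHS]/(c * v 'X_[a] + w 'X_[a]) vt // wt //.
  by rewrite mulr0 addr0.
rewrite scaler_sumr -big_split /=; apply: eq_bigr => a _.
by rewrite scalerA -scalerDl.
Qed.

End Facts.

(* Main.v *)
(** On [D0] the operator [Phi i] is the transpose of multiplication by [x_i]:
    [Phi i v g = v (x_i g)].  Every element of [I] is a combination of products
    [x^b f_k]; when [b != 0], splitting off a variable [x_j] makes [v] vanish
    on [x^b f_k] because [Phi j v] annihilates [I], so that only the values
    [v (f_k)] matter, and these are automatically zero unless [f_k] has
    degree [m]. *)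
Require Import Defs.
From HB Require Import structures.
From mathcomp Require Import all_boot all_order all_algebra.
From mathcomp Require Import boolp classical_sets functions cardinality fsbigop.
From mathcomp Require Import reals complex mpoly.

Set Implicit Arguments.
Unset Strict Implicit.

Import Order.TTheory GRing.Theory Num.Theory.
Local Open Scope ring_scope.
Local Open Scope classical_set_scope.

Section Span.
Context {F : fieldType} {V : lmodType F}.
Implicit Types A B : set V.

(** Induction principle for spans: applied below with [B] a property of functionals, it reduces
    claims about [D0] or [D0_deg] to the basis [pd a]. *)
Lemma lin_span_least A B : A `<=` B -> B 0 ->
  (forall c u v, B u -> B v -> B (c *: u + v)) -> lin_span A `<=` B.
Proof.
move=> AB B0 BD _ [n [c [u [uA ->]]]].
by elim/big_rec: _ => [//|i v _ Bv]; apply: BD => //; exact: AB.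
Qed.

Lemma lin_span_gen A : A `<=` lin_span A.
Proof.
move=> v Av; exists 1%N, (fun=> 1), (fun=> v); split=> //.
by rewrite big_ord1 scale1r.
Qed.

Lemma lin_span0 A : lin_span A 0.
Proof. by exists 0%N, (fun=> 0), (fun=> 0); split=> [[]//|]; rewrite big_ord0. Qed.

Lemma lin_spanP A c u v :
  lin_span A u -> lin_span A v -> lin_span A (c *: u + v).
Proof.
move=> [n1 [c1 [u1 [u1A ->]]]] [n2 [c2 [u2 [u2A ->]]]].
exists (n1 + n2)%N.
(* The two families are concatenated, with [c] absorbed into the coefficients of the first. *)
exists (fun i : 'I_(n1 + n2) =>
  match fintype.split i with inl j => c * c1 j | inr j => c2 j end).
exists (fun i : 'I_(n1 + n2) =>
  match fintype.split i with inl j => u1 j | inr j => u2 j end).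
split=> [i|]; first by case: fintype.split.
rewrite big_split_ord scaler_sumr /=; congr (_ + _); apply: eq_bigr => i _.
- by rewrite -/(unsplit (inl i)) unsplitK scalerA.
- by rewrite -/(unsplit (inr i)) unsplitK.
Qed.

Lemma lin_spanS A B : A `<=` B -> lin_span A `<=` lin_span B.
Proof. by move=> AB v [n [c [u [uA ->]]]]; exists n, c, u; split=> // i; exact: AB. Qed.

End Span.

Section Ideal.
Context {F : numFieldType} {N : nat}.
Implicit Types (G : set {mpoly F[N]}) (p g : {mpoly F[N]}).

Lemma ideal_gen_mull G p g : ideal_gen G g -> ideal_gen G (p * g).
Proof.
move=> [n [h [u [uG ->]]]]; exists n, (fun i => p * h i), u; split=> //.
by rewrite mulr_sumr; apply: eq_bigr => i _; rewrite mulrA.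
Qed.

Lemma ideal_gen_gen G : G `<=` ideal_gen G.
Proof.
move=> g Gg; exists 1%N, (fun=> 1), (fun=> g); split=> //.
by rewrite big_ord1 mul1r.
Qed.

End Ideal.

Section Dual.
Context {F : numFieldType} {N : nat}.
Local Notation dual := ({mpoly F[N]} -> F^o).
Implicit Types (v : dual) (g p : {mpoly F[N]}).

(** Elements of [dual] are bare functions; those of [D0] inherit linearity from coefficient
    extraction, since [pd a] reads off the coefficient at [a]. *)
Lemma D0_linear v c p g : D0 v -> v (c *: p + g) = c * v p + v g.
Proof.
move: v; apply: lin_span_least => [_ [a _ <-]||k u w uE wE].
- by rewrite !pdE mcoeffD mcoeffZ.
- by rewrite -[LHS]/(0 : F) -[RHS]/(c * 0 + 0 : F) mulr0 addr0.
- rewrite !fctE uE wE /GRing.scale /= !mulrDr !mulrA (mulrC k).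
  by rewrite addrACA.
Qed.

Lemma D0_0 v : D0 v -> v 0 = 0.
Proof.
move=> Dv; have := D0_linear 1 0 0 Dv.
by rewrite scaler0 addr0 mul1r => /eqP; rewrite -subr_eq subrr => /eqP <-.
Qed.

Lemma D0_Phi_mul v i g : D0 v -> Phi i v g = v ('X_i * g).
Proof.
(* [D0 u] is carried through the induction because [Phi i] is known to be linear only on [D0]. *)
move=> Dv; suff [] : [set u : dual | D0 u /\ Phi i u g = u ('X_i * g)] v by [].
move: v Dv; apply: lin_span_least => [_ [a _ <-]||c u w [Du uE] [Dw wE]].
- split; first by apply: lin_span_gen; exists a.
  rewrite Phi_pd pdE mulrC; case: ifPn => [ai|ai].
    (* Multiplication by ['X_i] shifts the coefficient at [a - U_(i)] to [a]. *)
    by rewrite pdE -{2}(@submK _ U_(i)%MM a) ?lep1mP -?lt0n // addmC mcoeffMX.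
  (* If [a i] is zero, [a] is not in the support of a multiple of ['X_i], so both sides vanish. *)
  symmetry; apply: memN_msupp_eq0; rewrite (perm_mem (msuppMX _ _)).
  apply: contra ai => /mapP[b _ ->].
  by rewrite mnmDE mnm1E eqxx.
- split; first exact: lin_span0.
  by rewrite (@PhiE _ _ i 0 [::]) // big_nil.
- split; first exact: lin_spanP.
  by rewrite Phi_linear_D0 // !fctE uE wE.
Qed.

End Dual.

Section GradedDual.
Context {F : numFieldType} {N : nat} {M : zmodType} (d : 'I_N -> M).
Local Notation dual := ({mpoly F[N]} -> F^o).
Implicit Types (v : dual) (g : {mpoly F[N]}).

Lemma D0_deg_D0 m : D0_deg (F := F) d m `<=` @D0 F N.
Proof. by apply: lin_spanS => _ [a _ <-]; exists a. Qed.

Lemma mondegB (a : 'X_{1..N}) i : (0 < a i)%N ->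
  mondeg d (a - U_(i))%MM = mondeg d a - d i.
Proof.
move=> ai; rewrite /mondeg (bigD1 i) //= [X in _ = X - _](bigD1 i) //=.
rewrite mnmBE mnm1E eqxx mulrnBr // mulr1n addrAC; congr (_ + _ - _).
by apply: eq_bigr => j ji; rewrite mnmBE mnm1E eq_sym (negbTE ji) subn0.
Qed.

(** On [pd a], removing one factor [x_i] lowers the degree by [d i]; if there is none, the result is
    zero, which lies in every span. *)
Lemma Phi_D0_deg m i v : D0_deg d m v -> D0_deg d (m - d i) (Phi i v).
Proof.
move=> Dv.
suff [] : [set u : dual | D0 u /\ D0_deg d (m - d i) (Phi i u)] v by [].
move: v Dv; apply: lin_span_least => [_ [a am <-]||c u w [Du uE] [Dw wE]].
- split; first by apply: lin_span_gen; exists a.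
  rewrite Phi_pd; case: ifPn => [ai|_]; last exact: lin_span0.
  by apply: lin_span_gen; exists (a - U_(i))%MM => //=; rewrite mondegB // am.
- split; first exact: lin_span0.
  by rewrite (@PhiE _ _ i 0 [::]) // big_nil; exact: lin_span0.
- split; first exact: lin_spanP.
  by rewrite Phi_linear_D0 //; exact: lin_spanP.
Qed.

Lemma graded_piece_coef m g a :
  graded_piece d m g -> mondeg d a != m -> g@_a = 0.
Proof.
move=> + am; move: g.
apply: lin_span_least => [_ [b bm <-]||c p q /= pE qE] /=.
- by rewrite mcoeffX; case: eqP => // ba; rewrite -ba bm eqxx in am.
- by rewrite mcoeff0.
- by rewrite mcoeffD mcoeffZ pE qE mulr0 addr0.
Qed.

(** A functional of degree [m] only reads coefficients of degree [m], and these are zero in [g]. *)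
Lemma D0_deg_graded_piece m m' v g :
  D0_deg d m v -> graded_piece d m' g -> m != m' -> v g = 0.
Proof.
move=> + gm' mm'; move: v.
apply: lin_span_least => [_ [a am <-]||c u w /= uE wE] /=.
- by rewrite pdE (graded_piece_coef gm') // am.
- by [].
- by rewrite !fctE uE wE scaler0 addr0.
Qed.

Lemma D0_deg_perp_closedness t (f : 'I_t -> {mpoly F[N]}) m :
  (forall i, exists m, graded_piece d m (f i)) ->
  D0_deg_perp d (ideal_gen (range f)) m =
  [set v | closedness d (ideal_gen (range f)) m v /\
           forall i, graded_piece d m (f i) -> v (f i) = 0].
Proof.
move=> f_homog; set I := ideal_gen _.
have If i : I (f i) by apply: ideal_gen_gen; exists i.
apply/seteqP; split=> v /=.
- move=> [Dmv [Dv Iv]]; split=> [|i _]; last exact/Iv/If.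
  split=> // i; have Dmi := Phi_D0_deg i Dmv.
  split=> //; split=> [|g Ig]; first exact: D0_deg_D0 Dmi.
  (* [Phi i v] kills [g] because ['X_i * g] is again in [I]. *)
  by rewrite D0_Phi_mul //; apply/Iv/ideal_gen_mull.
- move=> [[Dmv PhiI] vf]; have Dv := D0_deg_D0 Dmv.
  have vf0 i : v (f i) = 0.
    have [m' fm'] := f_homog i.
    have [mm'|mm'] := eqVneq m m'; first by apply: vf; rewrite mm'.
    exact: D0_deg_graded_piece Dmv fm' mm'.
  have vXf (b : 'X_{1..N}) i : v ('X_[b] * f i) = 0.
    have [->|b0] := eqVneq b 0%MM; first by rewrite mpolyX0 mul1r.
    have /existsP[j bj] : [exists j, b j != 0%N].
      apply: contraNT b0; rewrite negb_exists => /forallP b0.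
      by apply/eqP/mnmP => j; rewrite mnm0E; apply/eqP; rewrite -[_ == _]negbK.
    have jb : (U_(j) <= b)%MM by rewrite lep1mP.
    (* One factor ['X_j] moves onto [v] as [Phi j]; the cofactor ['X_[b - U_(j)] * f i] still lies
       in [I]. *)
    rewrite -(submK jb) addmC mpolyXD -mulrA -D0_Phi_mul //.
    have [_ [_]] := PhiI j; apply; exact/ideal_gen_mull/If.
  (* Linearity extends the vanishing from monomial multipliers to arbitrary [h], term by term. *)
  have vhf h i : v (h * f i) = 0.
    elim/mpolyind: h => [|c b p _ _ IHp]; first by rewrite mul0r D0_0.
    by rewrite mulrDl -scalerAl D0_linear // vXf IHp mulr0 addr0.
  split=> //; split=> // _ [n [h [g [gf ->]]]].
  elim/big_rec: _ => [|i p _ vp]; first exact: D0_0.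
  have [k _ <-] := gf i.
  by rewrite -[h i * _]scale1r D0_linear // vhf vp mulr0 addr0.
Qed.

End GradedDual.

Theorem corollary3p6 (R : realType) (N : nat) (M : zmodType)
    (M_fg : finitely_generated M) (d : 'I_N -> M)
    (dim_R0 : has_dim (graded_piece (F := R[i]) d 0) 1)
    (t : nat) (f : 'I_t -> {mpoly R[i][N]}) (I : set {mpoly R[i][N]})
    (I_gen : I = ideal_gen (range f)) (I_graded : graded_ideal d I)
    (f_homog : forall i, exists m, graded_piece d m (f i)) (m : M) :
  D0_deg_perp d I m =
  [set v | closedness d I m v /\
           forall i, graded_piece d m (f i) -> v (f i) = 0].
Proof. by rewrite I_gen; exact: D0_deg_perp_closedness. Qed.
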